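(* For every $n\ge 1$ and $d\ge 0$, restriction of functionals induces a natural isomorphism $$\mathcal C_d(n)^*\;\cong\;\frac{K^{\Sigma}_d(n)}{\rho_d(K_d(n))}.$$ Equivalently, evaluation induces a natural (well-defined) perfect pairing $$\mathcal C_d(n)\otimes \frac{K^{\Sigma}_d(n)}{\rho_d(K_d(n))}\longrightarrow \mathbf F_2,\qquad ([b],[\Theta])\longmapsto \Theta(b).$$
   Context: Let $P(n)=\mathbf F_2[x_1,\dots,x_n]$ with $|x_i|=1$, graded by degree, a left module over the mod 2 Steenrod algebra $\mathcal A$ (with augmentation ideal $\mathcal A^+$); the total square $\mathrm{Sq}=\sum_r \mathrm{Sq}^r$ is the algebra endomorphism with $\mathrm{Sq}(x_i)=x_i+x_i^2$. $\Sigma_n$ permutes the variables, and $B(n)=P(n)^{\Sigma_n}$ is an $\mathcal A$-submodule. For a graded left $\mathcal A$-module $M$, $\mathcal H^d(M)=\sum_{r>0}\mathrm{Sq}^r(M^{d-r})$ is the degree-$d$ hit subspace (its elements are called hit in $M$) and $Q_d(M)=M^d/\mathcal H^d(M)$. The inclusion $B(n)\hookrightarrow P(n)$ induces $\bar\iota_d:Q_d(B(n))\to Q_d(P(n))$, and the relative cohit space is $$\mathcal C_d(n)=\ker\bar\iota_d=\frac{B^d(n)\cap\mathcal H^d(P(n))}{\mathcal H^d(B(n))}.$$ For $M=P(n)$ or $B(n)$ and $\Psi\in (M^d)^*=\mathrm{Hom}_{\mathbf F_2}(M^d,\mathbf F_2)$, let $\mathrm{Sq}_{\downarrow}^r\Psi\in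 (M^{d-r})^*$ be given by $\langle \mathrm{Sq}_{\downarrow}^r\Psi,f\rangle=\langle\Psi,\mathrm{Sq}^r f\rangle$. The ordinary Steenrod kernel is $K_d(n)=\{\Psi\in (P^d(n))^*:\mathrm{Sq}_{\downarrow}^r\Psi=0\ \forall r>0\}$ and the symmetric Steenrod kernel is $K^\Sigma_d(n)=\{\Theta\in (B^d(n))^*:\mathrm{Sq}_{\downarrow}^r\Theta=0\ \forall r>0\}$. The map $\rho_d:K_d(n)\to K^\Sigma_d(n)$ is restriction, $\rho_d(\Psi)=\Psi|_{B^d(n)}$. *)

(* Defs.v *)
From HB Require Import structures.
From mathcomp Require Import all_boot all_order all_algebra all_fingroup.
From mathcomp Require Import generic_quotient ring_quotient sesquilinear.
From mathcomp Require Import mpoly.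

Set Implicit Arguments.
Unset Strict Implicit.
Unset Printing Implicit Defensive.

Import GRing.Theory.
Local Open Scope ring_scope.

(* The quotient V / W of a finite-dimensional vector space by a subspace:
   the quotient of the additive group V by W from ring_quotient, with its
   vector space structure. *)
Section QuotientSpace.
Import VectorInternalTheory.
Local Open Scope quotient_scope.
Context (K : fieldType) (V : vectType K) (W : {vspace V}).

Definition vquot : Type := Quotient.quot (pred_of_vspace W).
HB.instance Definition _ := EqQuotient.on vquot.
HB.instance Definition _ := Choice.on vquot.
HB.instance Definition _ := GRing.Zmodule.on vquot.

Definition vclass (x : V) : vquot := \pi_(Quotient.quot (pred_of_vspace W)) x.
Definition vrepr (q : vquot) : V := repr q.

Lemma vreprK : cancel vrepr vclass.
Proof. by move=> q; exact: reprK. Qed.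

Lemma vclass_eq x y : (vclass x == vclass y) = (x - y \in W).
Proof. by rewrite [RHS](Quotient.idealrBE (pred_of_vspace W)). Qed.

Lemma vreprP x : vrepr (vclass x) - x \in W.
Proof. by rewrite -vclass_eq vreprK. Qed.

Lemma vclassB : {morph vclass : x y / x - y}.
Proof. by move=> x y; exact: raddfB. Qed.

Lemma vclassD : {morph vclass : x y / x + y}.
Proof. by move=> x y; exact: raddfD. Qed.

Definition vquot_scale (a : K) (q : vquot) : vquot := vclass (a *: vrepr q).

Lemma vclassZ_subproof a x : vclass (a *: x) = vquot_scale a (vclass x).
Proof.
by apply/eqP; rewrite eq_sym vclass_eq -scalerBr memvZ // vreprP.
Qed.

Fact vquot_scaleA a b q :
  vquot_scale a (vquot_scale b q) = vquot_scale (a * b) q.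
Proof. by rewrite -[q]vreprK -!vclassZ_subproof scalerA. Qed.
Fact vquot_scale1 : left_id 1 vquot_scale.
Proof. by move=> q; rewrite -[q]vreprK -vclassZ_subproof scale1r. Qed.
Fact vquot_scaleDr : right_distributive vquot_scale +%R.
Proof.
move=> a p q; rewrite -[p]vreprK -[q]vreprK -vclassD -!vclassZ_subproof.
by rewrite scalerDr vclassD.
Qed.
Fact vquot_scaleDl q : {morph vquot_scale^~ q : a b / a + b}.
Proof.
move=> a b; rewrite -[q]vreprK -!vclassZ_subproof -vclassD.
by rewrite scalerDl.
Qed.

HB.instance Definition _ := GRing.Zmodule_isLmodule.Build K vquot
  vquot_scaleA vquot_scale1 vquot_scaleDr vquot_scaleDl.

Fact vclass_is_linear : linear vclass.
Proof. by move=> a x y; rewrite vclassD vclassZ_subproof. Qed.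
HB.instance Definition _ :=
  GRing.isLinear.Build K V vquot _ vclass vclass_is_linear.

Lemma vclass_eq0 x : (vclass x == 0) = (x \in W).
Proof. by rewrite -(raddf0 vclass) vclass_eq subr0. Qed.

Fact vquot_vecaxiom : Vector.axiom (dim (subvs_of W^C)) vquot.
Proof.
pose p := daddv_pi W^C W.
have dxv : (W^C :&: W = 0)%VS by rewrite capvC capv_compl.
have pW x : (x \in W) = (p x == 0).
  have dx : x = p x + daddv_pi W W^C x.
    rewrite daddv_pi_add //; last by rewrite addvC addv_complf memvf.
  apply/idP/eqP => [xW|p0]; last by rewrite dx p0 add0r memv_pi.
  have : p x \in (W^C :&: W)%VS.
    rewrite memv_cap memv_pi /=.
    have -> : p x = x - daddv_pi W W^C x by rewrite [X in X - _]dx addrK.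
    by rewrite memvB // memv_pi.
  by rewrite dxv memv0 => /eqP.
pose f (q : vquot) := v2r (vsproj W^C (p (vrepr q))).
have fE x : f (vclass x) = v2r (vsproj W^C (p x)).
  congr (v2r (vsproj _ _)); apply/eqP; rewrite -subr_eq0 -linearB /= -pW.
  exact: vreprP.
exists f.
  move=> a q1 q2; rewrite -[q1]vreprK -[q2]vreprK -linearP !fE.
  by rewrite !linearP.
exists (fun r => vclass (vsval (r2v r))) => [q|r].
  rewrite -[q]vreprK fE v2rK vsprojK ?memv_pi //.
  apply/eqP; rewrite vclass_eq pW linearB /= subr_eq0.
  by rewrite [p (p _)]daddv_pi_id // memv_pi.
rewrite fE [p _]daddv_pi_id ?subvsP //.
by rewrite vsvalK r2vK.
Qed.
HB.instance Definition _ := Lmodule_hasFinDim.Build K vquot vquot_vecaxiom.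

End QuotientSpace.

Definition vquot_map (K : fieldType) (V V' : vectType K) (W : {vspace V})
    (W' : {vspace V'}) (f : 'Hom(V, V')) : 'Hom(vquot W, vquot W') :=
  linfun (fun q => vclass W' (f (vrepr q))).

Lemma vquot_mapE (K : fieldType) (V V' : vectType K) (W : {vspace V})
    (W' : {vspace V'}) (f : 'Hom(V, V')) (x : V) :
  (f @: W <= W')%VS -> vquot_map W W' f (vclass W x) = vclass W' (f x).
Proof.
move=> sfW.
pose g q := vclass W' (f (vrepr (q : vquot W))).
have gE y : g (vclass W y) = vclass W' (f y).
  apply/eqP; rewrite vclass_eq -linearB /=.
  exact/(subvP sfW)/memv_img/vreprP.
have g_lin : linear g.
  move=> a q1 q2; rewrite -[q1]vreprK -[q2]vreprK -linearP !gE.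
  by rewrite !linearP.
pose gL := GRing.isLinear.Build K _ _ _ g g_lin.
pose gl : {linear vquot W -> vquot W'} := HB.pack g gL.
by rewrite -gE; exact: (lfunE gl).
Qed.

Notation dual V := 'Hom(V, ('F_2)^o).

Definition perfect_pairing (U V : vectType 'F_2)
    (e : {bilinear U -> V -> ('F_2)^o}) : Prop :=
  bijective (fun u : U => linfun (e u) : dual V) /\
  bijective (fun v : V => linfun (e^~ v) : dual U).

(* Graded F_2-modules of finite type with Steenrod squares; only the individual
   squares of the A-module structure are recorded. [sq M r d] is
   Sq^r : M^(d-r) -> M^d.  The subtraction of naturals is truncated, so only
   the maps with r <= d are meaningful: M^(d-r) = 0 when r > d, and the
   definitions below do not use those maps. *)
Record sqModule := SqModule {
  sqm_deg :> nat -> vectType 'F_2;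
  sq : forall r d : nat, 'Hom(sqm_deg (d - r)%N, sqm_deg d)
}.

Section SqModuleTheory.
Variables (M : sqModule) (d : nat).

Definition hit : {vspace M d} := (\sum_(1 <= r < d.+1) limg (sq M r d))%VS.

Definition cohit : vectType 'F_2 := vquot hit.

Definition sqdown (r : nat) (Psi : dual (M d)) : dual (M (d - r)%N) :=
  (Psi \o sq M r d)%VF.

Fact sqdown_is_linear r : linear (sqdown r).
Proof. by move=> a f g; rewrite /sqdown comp_lfunDl comp_lfunZl. Qed.
HB.instance Definition _ r :=
  GRing.isLinear.Build 'F_2 (dual (M d)) (dual (M (d - r)%N)) _ (sqdown r)
    (sqdown_is_linear r).

Definition steenrod_kernel : {vspace dual (M d)} :=
  (\bigcap_(r < d.+1 | (0 < r)%N) lker (linfun (sqdown r)))%VS.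

Lemma steenrod_kernelP (Psi : dual (M d)) :
  reflect (forall r, (0 < r <= d)%N -> sqdown r Psi = 0)
          (Psi \in steenrod_kernel).
Proof.
rewrite memvE; apply: (iffP subv_bigcapP) => [H r /andP[r0 rd]|H i i0].
  have := H (Ordinal (rd : (r < d.+1)%N)) r0.
  by rewrite -memvE memv_ker lfunE => /eqP.
by rewrite -memvE memv_ker lfunE /= H // i0 -ltnS ltn_ord.
Qed.

End SqModuleTheory.

Section Polynomials.
Variable n : nat.

Definition Sqtot (p : {mpoly 'F_2[n]}) : {mpoly 'F_2[n]} :=
  p \mPo [tuple 'X_i + 'X_i ^+ 2 | i < n].
HB.instance Definition _ := GRing.LRMorphism.copy Sqtot
  (comp_mpoly [tuple ('X_i + 'X_i ^+ 2 : {mpoly 'F_2[n]}) | i < n]).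

Lemma SqtotX (i : 'I_n) : Sqtot 'X_i = 'X_i + 'X_i ^+ 2.
Proof. by rewrite /Sqtot comp_mpolyXU -tnth_nth tnth_mktuple. Qed.

(* Sq^r raises degrees by r, so on the degree-e component of p it picks the
   component of degree e + r of the total square. *)
Definition Sq (r : nat) (p : {mpoly 'F_2[n]}) : {mpoly 'F_2[n]} :=
  \sum_(e < msize p) pihomog mdeg (e + r)%N (Sqtot (pihomog mdeg e p)).

Lemma Sq_dhomog r e p :
  p \is e.-homog -> Sq r p = pihomog mdeg (e + r)%N (Sqtot p).
Proof.
move=> hp; have [->|p0] := eqVneq p 0.
  by rewrite /Sq msize0 big_ord0 !raddf0.
have ep : (e < msize p)%N.
  by have := dhomog_msize hp; move/(dhomog_uniq p0 hp) ->;
     rewrite prednK // lt0n msize_poly_eq0.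
rewrite /Sq (bigD1 (Ordinal ep)) //= (pihomog_dE hp) big1 ?addr0 // => i ne.
have ei : e != i by apply: contraNneq ne => ei; apply/eqP/val_inj.
by rewrite (pihomog_ne0 ei hp) !raddf0.
Qed.

Lemma Sq_is_homog r e p : p \is e.-homog -> Sq r p \is (e + r)%N.-homog.
Proof. by move=> hp; rewrite (Sq_dhomog r hp) pihomogP. Qed.

Lemma msym_Sqtot (s : 'S_n) (p : {mpoly 'F_2[n]}) :
  msym s (Sqtot p) = Sqtot (msym s p).
Proof.
rewrite [in RHS]/Sqtot msym_mPo /Sqtot.
rewrite !comp_mpolyE raddf_sum /=; apply: eq_bigr => m _.
rewrite linearZ /= rmorph_prod /=; congr (_ *: _); apply: eq_bigr => i _.
rewrite rmorphXn /= !tnth_mktuple rmorphD rmorphXn /= !msymX.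
suff -> : [multinom U_(i)%MM ((s^-1)%g i0) | i0 < n] = U_(s i)%MM by [].
apply/mnmP => j; rewrite mnmE !mnm1E; congr (nat_of_bool _).
by rewrite -(inj_eq (@perm_inj _ s)) permKV.
Qed.

Lemma msym_Sq (s : 'S_n) r e (p : {mpoly 'F_2[n]}) :
  p \is e.-homog -> msym s p \is e.-homog -> msym s (Sq r p) = Sq r (msym s p).
Proof.
by move=> hp hsp; rewrite (Sq_dhomog r hp) (Sq_dhomog r hsp) msym_pihomog
  msym_Sqtot.
Qed.

Lemma msym_homog (s : 'S_n) d (p : {mpoly 'F_2[n]}) :
  p \is d.-homog -> msym s p \is d.-homog.
Proof. by rewrite !homog_piE => /eqP hp; rewrite -msym_pihomog hp. Qed.

(* multinomials only makes [dhomog n R d] a vectType for n of the form n'.+1. *)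
Definition Pdeg (d : nat) : Type := dhomog n 'F_2 d.
HB.instance Definition _ d := SubChoice.on (Pdeg d).
HB.instance Definition _ d := GRing.Lmodule.on (Pdeg d).

End Polynomials.

Lemma Pdeg0_vecaxiom d : Vector.axiom (d == 0%N) (Pdeg 0 d).
Proof.
have m0 (m : 'X_{1..0}) : m = 0%MM by apply/mnmP => -[].
exists (fun p : Pdeg 0 d => const_mx (val p)@_0) => [a p q|].
  by apply/rowP=> i; rewrite !mxE /= mcoeffD mcoeffZ.
have [->|d0] := eqVneq d 0%N.
  have c0 (c : 'F_2) : c%:MP_[0] \is 0.-homog.
    by apply/dhomogP => m _; rewrite (m0 m) [LHS]mdeg0.
  exists (fun r : 'rV_1 => DHomog (c0 (r 0 0)) : Pdeg 0 0) => [p|r].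
    by apply/val_inj/mpolyP => m; rewrite /= mxE mcoeffC (m0 m) eqxx mulr1.
  by apply/rowP => i; rewrite mxE /= mcoeffC eqxx mulr1 ord1.
exists (fun=> 0 : Pdeg 0 d) => [p|r]; last by apply/rowP => -[].
apply/esym/val_inj/mpolyP => m; rewrite mcoeff0 (m0 m).
apply: (@dhomog_nemf_coeff _ _ mdeg d); first exact: valP.
by rewrite [mf in mf != _]mdeg0 eq_sym.
Qed.

Lemma Pdeg_vecaxiom n d : {k : nat & Vector.axiom k (Pdeg n d)}.
Proof.
case: n => [|n]; first by exists (d == 0%N); exact: Pdeg0_vecaxiom.
by exists 'C(d + n, d); exact: dhomog_vecaxiom.
Qed.
HB.instance Definition _ n d :=
  Lmodule_hasFinDim.Build 'F_2 (Pdeg n d) (projT2 (Pdeg_vecaxiom n d)).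

Section RelativeCohits.
Variable n : nat.

(* The degree-d component of Sq^r f: this is Sq^r f itself when r <= d
   (lemma [SqPE]), and 0 when r > d. *)
Definition SqP_fun r d (f : Pdeg n (d - r)%N) : Pdeg n d :=
  DHomog (pihomogP mdeg d (Sq r (val f))).

Fact SqP_fun_linear r d : linear (@SqP_fun r d).
Proof.
move=> a f g; apply: val_inj; rewrite [RHS]/= [LHS]/= -[RHS]linearP /=.
have E (h : Pdeg n (d - r)%N) :
    Sq r (val h) = pihomog mdeg (d - r + r)%N (Sqtot (val h)).
  by apply: Sq_dhomog; exact: valP h.
congr (pihomog _ _ _); rewrite (E (a *: f + g)) (E f) (E g).
by rewrite -!linearP.
Qed.
HB.instance Definition _ r d := GRing.isLinear.Build 'F_2
  (Pdeg n (d - r)%N) (Pdeg n d) _ (@SqP_fun r d) (@SqP_fun_linear r d).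

Definition SqP r d : 'Hom(Pdeg n (d - r)%N, Pdeg n d) := linfun (@SqP_fun r d).

Lemma SqPE r d (f : Pdeg n (d - r)%N) :
  (r <= d)%N -> val (SqP r d f) = Sq r (val f).
Proof.
move=> rd; rewrite lfunE /= pihomog_dE // -[d in d.-homog](subnK rd).
exact/Sq_is_homog/valP.
Qed.

Definition P : sqModule := @SqModule (fun d => Pdeg n d) SqP.

Definition msymP_fun (s : 'S_n) d (f : Pdeg n d) : Pdeg n d :=
  DHomog (msym_homog s (valP f)).
Fact msymP_fun_linear s d : linear (@msymP_fun s d).
Proof. by move=> a f g; apply: val_inj; rewrite /= linearP. Qed.
HB.instance Definition _ s d := GRing.isLinear.Build 'F_2
  (Pdeg n d) (Pdeg n d) _ (@msymP_fun s d) (@msymP_fun_linear s d).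

Definition Bdeg d : {vspace P d} :=
  (\bigcap_(s : 'S_n) fixedSpace (linfun (@msymP_fun s d)))%VS.

Lemma mem_Bdeg d (f : P d) : (f \in Bdeg d) = (val f \is symmetric).
Proof.
rewrite memvE; apply/subv_bigcapP/issymP => [H s|H s _].
  have := H s isT; rewrite -memvE => /fixedSpaceP.
  by rewrite lfunE => /(congr1 val).
by rewrite -memvE; apply/fixedSpaceP; rewrite lfunE; apply: val_inj; exact: H.
Qed.

Lemma SqP_Bdeg r d (f : P (d - r)%N) : f \in Bdeg (d - r)%N -> SqP r d f \in Bdeg d.
Proof.
rewrite !mem_Bdeg lfunE /= => /issymP fs; apply: pihomog_sym; apply/issymP => s.
have hf : val f \is (d - r)%N.-homog by exact: valP.
by rewrite (msym_Sq r hf) ?fs.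
Qed.

(* [SqP r d] maps symmetric polynomials to symmetric polynomials, so that
   [vsproj] below only changes the type (lemma [SqBE]). *)
Definition SqB r d : 'Hom(subvs_of (Bdeg (d - r)%N), subvs_of (Bdeg d)) :=
  (linfun (vsproj (Bdeg d)) \o SqP r d \o linfun vsval)%VF.

Lemma SqBE r d (f : subvs_of (Bdeg (d - r)%N)) :
  vsval (SqB r d f) = SqP r d (vsval f).
Proof.
rewrite 2!comp_lfunE lfunE /= [linfun vsval f]lfunE /= vsprojK //.
exact/SqP_Bdeg/subvsP.
Qed.

Definition B : sqModule := @SqModule (fun d => subvs_of (Bdeg d)) SqB.

Variable d : nat.

Definition incl : 'Hom(B d, P d) := linfun vsval.

Lemma incl_sq r (f : B (d - r)%N) : incl (sq B r d f) = sq P r d (vsval f).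
Proof. by rewrite [LHS]lfunE; exact: SqBE. Qed.

Lemma incl_hit : (incl @: hit B d <= hit P d)%VS.
Proof.
rewrite /hit limg_sum 2!big_add1 /= !big_mkord; apply/subv_sumP => i _.
apply: (subv_trans _ (sumv_sup i isT (subvv _))).
apply/subvP => _ /memv_imgP[_ /memv_imgP[f _ ->] ->].
rewrite (incl_sq f : incl (SqB i.+1 d f) = SqP i.+1 d (vsval f)).
by rewrite memv_img ?memvf.
Qed.

Definition iota_bar : 'Hom(cohit B d, cohit P d) :=
  vquot_map (hit B d) (hit P d) incl.

Lemma iota_barE (b : B d) : iota_bar (vclass _ b) = vclass _ (vsval b).
Proof. by rewrite /iota_bar vquot_mapE ?incl_hit // lfunE. Qed.

Definition relcohit : vectType 'F_2 := subvs_of (lker iota_bar).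

Lemma mem_ker_iota_bar (b : B d) :
  (vclass (hit B d) b \in lker iota_bar) = (vsval b \in hit P d).
Proof. by rewrite memv_ker iota_barE vclass_eq0. Qed.

Definition K : {vspace dual (P d)} := steenrod_kernel P d.
Definition KSigma : {vspace dual (B d)} := steenrod_kernel B d.

Lemma restr_K (Psi : dual (P d)) : Psi \in K -> (Psi \o incl)%VF \in KSigma.
Proof.
move/steenrod_kernelP => H; apply/steenrod_kernelP => r rd.
apply/lfunP => f; rewrite zero_lfunE /sqdown 2!comp_lfunE incl_sq.
by have /lfunP/(_ (vsval f)) := H r rd; rewrite zero_lfunE comp_lfunE.
Qed.

(* The restriction of a functional of K lies in KSigma, so that [vsproj] only
   changes the type (lemma [rhoE]). *)
Definition rho_fun (Psi : subvs_of K) : subvs_of KSigma :=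
  vsproj KSigma (vsval Psi \o incl)%VF.
Fact rho_fun_linear : linear rho_fun.
Proof.
by move=> a f g; rewrite /rho_fun linearP comp_lfunDl -comp_lfunZl linearP.
Qed.
HB.instance Definition _ := GRing.isLinear.Build 'F_2
  (subvs_of K) (subvs_of KSigma) _ rho_fun rho_fun_linear.

Definition rho : 'Hom(subvs_of K, subvs_of KSigma) := linfun rho_fun.

Lemma rhoE (Psi : subvs_of K) (b : B d) :
  vsval (rho Psi) b = vsval Psi (vsval b).
Proof.
by rewrite lfunE /= vsprojK ?restr_K ?subvsP // comp_lfunE lfunE.
Qed.

Definition kernel_quot : vectType 'F_2 := vquot (limg rho).

End RelativeCohits.

(* Main.v *)
(* The two Steenrod kernels are the annihilators of the hit subspaces. A
   functional on B^d lifts to one on P^d annihilating the hits of P exactly when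
   it vanishes on B^d \cap H^d(P(n)): it then factors through the map
   B^d -> Q_d(P(n)), whose kernel is that intersection, and over a field it
   extends from the image to all of Q_d(P(n)). So the evaluation pairing is well
   defined and nondegenerate on the right; on the left it is nondegenerate since
   functionals annihilating H^d(B(n)) separate the points of Q_d(B(n)). In finite
   dimension, nondegenerate on both sides means perfect. *)
Require Import Defs.
From HB Require Import structures.
From mathcomp Require Import all_boot all_order all_algebra all_fingroup.
From mathcomp Require Import generic_quotient ring_quotient sesquilinear.
From mathcomp Require Import mpoly.

Set Implicit Arguments.
Unset Strict Implicit.
Unset Printing Implicit Defensive.

Import GRing.Theory.
Local Open Scope ring_scope.

(** [g^-1] is a pseudo-inverse: [u] and [g^-1 (g u)] have the same image under [g], so they differ
    by an element of its kernel, which [f] kills. *)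
Lemma lfun_factor (F : fieldType) (U V W : vectType F) (g : 'Hom(U, V))
    (f : 'Hom(U, W)) :
  (lker g <= lker f)%VS -> exists h : 'Hom(V, W), f = (h \o g)%VF.
Proof.
move=> /subvP sgf; exists (f \o g^-1)%VF; apply/lfunP => u.
rewrite !comp_lfunE; apply/eqP; rewrite -subr_eq0 -linearB -memv_ker /=.
by apply: sgf; rewrite memv_ker linearB /= limg_lfunVK ?subrr // memv_img ?memvf.
Qed.

Lemma dual_separates (F : fieldType) (V : vectType F) (W : {vspace V}) (v : V) :
  (forall f : 'Hom(V, F^o), (W <= lker f)%VS -> f v = 0) -> v \in W.
Proof.
move=> vanish; rewrite -vclass_eq0; apply/eqP/eqP/negPn/negP => v0.
pose scl (a : F^o) : vquot W := (a : F) *: vclass W v.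
have scl_lin : linear scl by move=> a x y; rewrite /scl scalerDl scalerA.
pose sclM := GRing.isLinear.Build F F^o (vquot W) _ scl scl_lin.
pose sclL : {linear F^o -> vquot W} := HB.pack scl sclM.
pose g : 'Hom(F^o, vquot W) := linfun sclL.
have gE a : g a = (a : F) *: vclass W v by rewrite lfunE.
(* As the class of [v] is nonzero, [g] is injective and the identity of [F] factors through it; [h]
   is then a functional on V / W with value 1 at that class. *)
have [|h hg] := @lfun_factor F F^o (vquot W) F^o g \1%VF.
  apply/subvP => a; rewrite !memv_ker gE id_lfunE scaler_eq0 (negPf v0) orbF //.
have := vanish (h \o linfun (vclass W))%VF.
rewrite comp_lfunE lfunE /= => H.
have /lfunP/(_ 1) := hg; rewrite id_lfunE comp_lfunE gE scale1r H.
  by move/eqP; rewrite oner_eq0.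
apply/subvP => w; rewrite -vclass_eq0 memv_ker comp_lfunE lfunE /= => /eqP ->.
by rewrite linear0.
Qed.

(** [sqdown r] is the transpose of Sq^r, so it kills [Psi] exactly when [Psi] vanishes on the image
    of Sq^r; these images for 0 < r <= d span the hits. *)
Lemma steenrod_kernel_hit (M : sqModule) d (Psi : dual (M d)) :
  (Psi \in steenrod_kernel M d) = (hit M d <= lker Psi)%VS.
Proof.
rewrite /hit big_add1 /= big_mkord.
apply/steenrod_kernelP/subv_sumP => [H i _ | H [//|r] /= rd].
  apply/subvP => _ /memv_imgP[f _ ->]; rewrite memv_ker.
  have := H i.+1 (ltn_ord i).
  by move=> /lfunP/(_ f); rewrite comp_lfunE zero_lfunE => ->.
apply/lfunP => f; rewrite comp_lfunE zero_lfunE; apply/eqP.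
rewrite -memv_ker; apply: (subvP (H (Ordinal rd) isT)).
by rewrite memv_img ?memvf.
Qed.

Lemma dim_dual (V : vectType 'F_2) : dim (dual V) = dim V.
Proof. exact: muln1. Qed.

Lemma lker0_bij (F : fieldType) (V W : vectType F) (f : 'Hom(V, W)) :
  dim V = dim W -> lker f == 0%VS -> bijective f.
Proof.
move=> dVW f0; have fT : limg f = fullv.
  apply/eqP; rewrite eqEdim subvf limg_dim_eq; last by rewrite (eqP f0) capv0.
  by rewrite !dimvf dVW /=.
exists (f^-1)%VF; first exact: lker0_lfunK.
by move=> w; rewrite limg_lfunVK // fT memvf.
Qed.

Section NondegeneratePairing.
Variables (U V : vectType 'F_2) (e : {bilinear U -> V -> ('F_2)^o}).

Let curryl (u : U) : dual V := linfun (e u).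
Let curryr (v : V) : dual U := linfun (e^~ v).

Fact currylE u v : curryl u v = e u v.
Proof. exact: (lfunE (e u)). Qed.

Fact curryrE v u : curryr v u = e u v.
Proof. exact: (lfunE (applyr e v)). Qed.

Fact curryl_is_linear : linear curryl.
Proof.
move=> a x y; apply/lfunP => v; rewrite add_lfunE scale_lfunE !currylE.
exact: linearPl.
Qed.

Fact curryr_is_linear : linear curryr.
Proof.
move=> a x y; apply/lfunP => u; rewrite add_lfunE scale_lfunE !curryrE.
exact: linearPr.
Qed.

Lemma nondegenerate_perfect :
  (forall u, (forall v, e u v = 0) -> u = 0) ->
  (forall v, (forall u, e u v = 0) -> v = 0) -> perfect_pairing e.
Proof.
move=> eU eV.
pose lM := GRing.isLinear.Build _ _ _ _ _ curryl_is_linear.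
pose l : {linear U -> dual V} := HB.pack curryl lM.
pose rM := GRing.isLinear.Build _ _ _ _ _ curryr_is_linear.
pose r : {linear V -> dual U} := HB.pack curryr rM.
have l0 : lker (linfun l) == 0%VS.
  apply/lker0P => u u'; rewrite !lfunE /= => /lfunP E.
  apply/eqP; rewrite -subr_eq0; apply/eqP/eU => v.
  by have := E v; rewrite !currylE linearBl => ->; rewrite subrr.
have r0 : lker (linfun r) == 0%VS.
  apply/lker0P => v v'; rewrite !lfunE /= => /lfunP E.
  apply/eqP; rewrite -subr_eq0; apply/eqP/eV => u.
  by have := E u; rewrite !curryrE linearBr => ->; rewrite subrr.
(* The injections [l] and [r] into the duals bound each dimension by the other; between spaces of
   equal finite dimension they are bijective. *)
have dUV : dim U = dim V.
  have dl := limg_dim_eq (f := linfun l) (U := fullv).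
  have dr := limg_dim_eq (f := linfun r) (U := fullv).
  apply/eqP; rewrite eqn_leq -{1}(dim_dual V) -{2}(dim_dual U) -!dimvf.
  by rewrite -dl ?(eqP l0) ?capv0 // -dr ?(eqP r0) ?capv0 // !dimvS ?subvf.
split; [have := lker0_bij _ l0 | have := lker0_bij _ r0].
  by rewrite dim_dual => /(_ dUV) bij_l; apply: (eq_bij bij_l) => u; rewrite lfunE.
by rewrite dim_dual => /(_ (esym dUV)) bij_r; apply: (eq_bij bij_r) => u; rewrite lfunE.
Qed.

End NondegeneratePairing.

Section RelativePairing.
Variables n d : nat.

Lemma KSigma_hit0 (Theta : subvs_of (KSigma n d)) (b : B n d) :
  b \in hit (B n) d -> vsval Theta b = 0.
Proof.
have := subvsP Theta; rewrite steenrod_kernel_hit => /subvP H /H.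
by rewrite memv_ker => /eqP.
Qed.

Lemma rho_im_hit0 (Theta : subvs_of (KSigma n d)) (b : B n d) :
  Theta \in limg (rho n d) -> vsval b \in hit (P n) d -> vsval Theta b = 0.
Proof.
move=> /memv_imgP[Psi _ ->] hb; rewrite rhoE.
have := subvsP Psi; rewrite steenrod_kernel_hit => /subvP/(_ _ hb).
by rewrite memv_ker => /eqP.
Qed.

Lemma hit0_rho_im (Theta : subvs_of (KSigma n d)) :
  (forall b : B n d, vsval b \in hit (P n) d -> vsval Theta b = 0) ->
  Theta \in limg (rho n d).
Proof.
move=> Theta0; pose pr : 'Hom(P n d, cohit (P n) d) := linfun (vclass (hit (P n) d)).
have prE x : pr x = vclass (hit (P n) d) x by rewrite lfunE.
(* The kernel of [pr \o incl n d] is the set of symmetric polynomials hit in P(n), where [Theta]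
   vanishes; [Phi \o pr] will be the lift of [Theta]. *)
have [|Phi ThetaE] := @lfun_factor _ _ _ _ (pr \o incl n d)%VF (vsval Theta).
  apply/subvP => b; rewrite !memv_ker comp_lfunE [incl n d b]lfunE prE vclass_eq0.
  by move=> /Theta0 ->.
have PsiK : (Phi \o pr)%VF \in K n d.
  rewrite steenrod_kernel_hit; apply/subvP => x; rewrite -vclass_eq0 -prE.
  by rewrite memv_ker comp_lfunE => /eqP ->; rewrite linear0.
have -> : Theta = rho n d (Subvs PsiK).
  apply/val_inj/lfunP => b; rewrite [RHS]rhoE /= ThetaE !comp_lfunE.
  by rewrite [incl n d b]lfunE.
by rewrite memv_img ?memvf.
Qed.

Lemma relcohit_vreprP (c : relcohit n d) :
  vsval (vrepr (vsval c)) \in hit (P n) d.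
Proof. by rewrite -mem_ker_iota_bar vreprK subvsP. Qed.

(** Evaluation at chosen representatives; [rel_pairE] shows that the choice does not matter. *)
Definition rel_pair (c : relcohit n d) (q : kernel_quot n d) : ('F_2)^o :=
  vsval (vrepr q) (vrepr (vsval c)).

Lemma rel_pairE (Theta : subvs_of (KSigma n d)) (c : relcohit n d) (b : B n d) :
  vsval c = vclass (hit (B n) d) b ->
  rel_pair c (vclass (limg (rho n d)) Theta) = vsval Theta b.
Proof.
move=> cE; rewrite /rel_pair; set b' := vrepr (vsval c).
(* Two representatives of [c] differ by a hit of B(n), which [Theta] kills. *)
have -> : vsval Theta b = vsval Theta b'.
  apply/eqP; rewrite eq_sym -subr_eq0 -linearB; apply/eqP/KSigma_hit0.
  by rewrite /b' cE vreprP.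
(* Two representatives of the class of [Theta] differ by a restriction from [K], which vanishes at
   [b'] because [b'] is hit in P(n). *)
apply/eqP; rewrite -subr_eq0 -opp_lfunE -add_lfunE -linearB; apply/eqP.
exact: rho_im_hit0 (vreprP _ _) (relcohit_vreprP c).
Qed.

Fact rel_pair_bilinear : bilinear_for *:%R *:%R rel_pair.
Proof.
split=> [q a c c'|c a q q'].
  rewrite -[q]vreprK (rel_pairE _ (esym (vreprK (vsval c)))).
  rewrite (rel_pairE _ (esym (vreprK (vsval c')))) -linearP.
  (* A combination of chosen representatives need not be the chosen one of the combined class, but
     it does represent it. *)
  by apply: rel_pairE; rewrite !linearP /= !vreprK.
rewrite -[q]vreprK -[q']vreprK -linearP.
by rewrite !(rel_pairE _ (esym (vreprK _))) linearP add_lfunE scale_lfunE.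
Qed.
HB.instance Definition _ := bilinear_isBilinear.Build 'F_2 (relcohit n d)
  (kernel_quot n d) ('F_2)^o *:%R *:%R rel_pair rel_pair_bilinear.

Lemma rel_pair_perfect : perfect_pairing rel_pair.
Proof.
apply: nondegenerate_perfect => [c c0 | q q0].
  (* Every functional killing the hits of B(n) lies in [KSigma], so by [c0] it vanishes at the
     representative of [c], which is therefore a hit. *)
  apply/val_inj; rewrite -[val c]vreprK; apply/eqP; rewrite vclass_eq0.
  apply: dual_separates => f; rewrite -steenrod_kernel_hit => fK.
  rewrite -[f]/(vsval (Subvs (fK : f \in KSigma n d))).
  by rewrite -(rel_pairE _ (esym (vreprK (vsval c)))); exact: c0.
(* A symmetric [b] that is hit in P(n) defines a class in the relative cohit space, so [q0] makes
   the representative of [q] vanish at [b]. *)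
rewrite -[q]vreprK; apply/eqP; rewrite vclass_eq0; apply: hit0_rho_im => b.
rewrite -mem_ker_iota_bar => bker; rewrite -(q0 (Subvs bker)) -[in RHS](vreprK q).
by apply/esym/rel_pairE.
Qed.

End RelativePairing.

Theorem theorem1p1 (n d : nat) (hn : (0 < n)%N) :
  (exists phi : 'Hom(kernel_quot n d, dual (relcohit n d)),
     bijective phi /\
     forall (Theta : subvs_of (KSigma n d)) (c : relcohit n d) (b : B n d),
       vsval c = vclass (hit (B n) d) b ->
       phi (vclass (limg (rho n d)) Theta) c = vsval Theta b)
  /\
  (exists e : {bilinear relcohit n d -> kernel_quot n d -> ('F_2)^o},
     perfect_pairing e /\
     forall (Theta : subvs_of (KSigma n d)) (c : relcohit n d) (b : B n d),
       vsval c = vclass (hit (B n) d) b ->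
       e c (vclass (limg (rho n d)) Theta) = vsval Theta b).
Proof.
have [_ bij_r] := rel_pair_perfect n d.
split; last first.
  by exists (@rel_pair n d); split; [exact: rel_pair_perfect | exact: rel_pairE].
(* The isomorphism is the pairing curried in its second argument, so its bijectivity is one half of
   perfectness. *)
pose phiM := GRing.isLinear.Build _ _ _ _ _ (curryr_is_linear (@rel_pair n d)).
pose phi : {linear kernel_quot n d -> dual (relcohit n d)} :=
  HB.pack (fun q => linfun ((@rel_pair n d)^~ q) : dual (relcohit n d)) phiM.
exists (linfun phi); split; first by apply: (eq_bij bij_r) => q; rewrite lfunE.
move=> Theta c b cE; rewrite [linfun phi _]lfunE /=.
by rewrite curryrE; exact: rel_pairE.
Qed.
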